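(* Consider the original Kuramoto model on the complete graph $K_N$, i.e. with $a_{ij}=1$ for $i\ne j$ and $a_{ii}=0$. A point $\theta_0=(\theta_1,\dots,\theta_N)\in\mathbb{R}^N$ is an equilibrium point of this model if and only if $\theta_0$ satisfies one of the following conditions: (1) the $\theta_i$ differ by integer multiples of $\pi$ (that is, $\theta_i-\theta_j\in\pi\mathbb{Z}$ for all $1\le i,j\le N$); (2) $\sum_{i=1}^N e^{\mathbf{i}\theta_i}=0$.
   Context: Here $\mathbf{i}=\sqrt{-1}$. The original Kuramoto model (with all natural frequencies equal to $0$ and coupling strength $\epsilon$) is $\frac{d\theta_i}{dt}=\epsilon\sum_{j=1}^N a_{ij}\sin(\theta_j-\theta_i)$, $1\le i\le N$, where $(a_{ij})$ is the adjacency matrix. A point $\theta_0=(\theta_1,\dots,\theta_N)\in\mathbb{R}^N$ is an equilibrium point of it if $\sum_{j=1}^N a_{ij}\sin(\theta_j-\theta_i)=0$ for all $1\le i\le N$. *)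

(* Defs.v *)
From HB Require Import structures.
From mathcomp Require Import all_boot all_order all_algebra.
From mathcomp Require Import complex.
From mathcomp Require Import all_classical all_reals all_analysis.

Set Implicit Arguments.
Unset Strict Implicit.
Unset Printing Implicit Defensive.

Import Order.TTheory GRing.Theory Num.Theory.
Import numFieldNormedType.Exports.

Local Open Scope classical_set_scope.
Local Open Scope ring_scope.
Local Open Scope complex_scope.

(* The regular module R[i]^o selects the normed topology of R[i] for the limit. *)
Definition expC (R : realType) (z : R[i]) : R[i] :=
  limn (series (fun n => z ^+ n / n`!%:R) : nat -> R[i]^o).

(* Equilibria of theta_i' = eps * \sum_j A i j * sin (theta_j - theta_i). *)
Definition kuramoto_equilibrium (R : realType) (N : nat)
    (A : 'M[R]_N) (theta : 'rV[R]_N) : Prop :=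
  forall i : 'I_N, \sum_(j < N) A i j * sin (theta 0 j - theta 0 i) = 0.

Definition complete_adj (R : realType) (N : nat) : 'M[R]_N :=
  \matrix_(i, j) (i != j)%:R.

(* Main.v *)
(* With C = \sum_j cos theta_j and S = \sum_j sin theta_j, the i-th equilibrium
   equation reads S cos theta_i = C sin theta_i, so every unit vector
   (cos theta_i, sin theta_i) is parallel to (C, S). If C + iS != 0, any two of
   these unit vectors are parallel, i.e. sin (theta_i - theta_j) = 0. *)
Require Import Defs.
From mathcomp Require Import all_boot all_order all_algebra.
From mathcomp Require Import complex ring.
From mathcomp Require Import all_classical all_reals all_analysis.
Import Order.TTheory GRing.Theory Num.Theory.
Import numFieldNormedType.Exports.
Local Open Scope ring_scope.
Local Open Scope complex_scope.

Lemma ler_normc (R : rcfType) (z : R[i]) :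
  `|z| <= (`|complex.Re z| + `|complex.Im z|)%:C.
Proof.
rewrite {1}[z]complexE (le_trans (ler_normD _ _))// normrM.
rewrite !normc_def /= !expr0n expr1n /= !add0r !addr0 !sqrtr_sqr sqrtr1.
by rewrite mul1r -rmorphD.
Qed.

(** The modulus is at most the sum of the absolute values of the two components, so half of the
    tolerance goes to each. *)
Lemma cvg_complex (R : realType) (u : nat -> R[i]^o) (a b : R) :
  ((fun n => complex.Re (u n)) @ \oo --> a)%classic ->
  ((fun n => complex.Im (u n)) @ \oo --> b)%classic ->
  (u @ \oo --> (a +i* b : R[i]^o))%classic.
Proof.
move=> ua ub; apply/cvgrPdist_lt => e e0.
(* The order on [R[i]] compares only numbers with equal imaginary parts, so [0 < e] makes [e]
   real. *)
have [r r0 ->] : exists2 r : R, 0 < r & e = r%:C.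
  exists (complex.Re e); first by move: e0; rewrite ltcE => /andP[].
  by rewrite RRe_real// gtr0_real.
have r20 : 0 < r / 2 by rewrite divr_gt0.
have /cvgrPdist_lt/(_ _ r20) ua' := ua.
have /cvgrPdist_lt/(_ _ r20) ub' := ub.
near=> n.
apply: le_lt_trans (ler_normc _ _) _.
rewrite ltcR !raddfB [ltRHS]splitr ltrD//.
- by near: n.
- by near: n.
Unshelve. all: by end_near. Qed.

(** Euler's formula: the exponential series at [it] has the cosine and sine series as its real and
    imaginary parts, term by term. *)
Lemma expC_i (R : realType) (t : R) :
  expC ('i%C * t%:C) = cos t +i* sin t.
Proof.
apply: (@cvg_lim R[i]^o); first exact: norm_hausdorff.
have coefE n : ('i%C * t%:C) ^+ n / n`!%:R = cos_coeff t n +i* sin_coeff t n.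
  (* Splitting [n] as [odd n + 2 * n./2] turns the power of [i] into [i ^ odd n] times a sign. *)
  rewrite exprMn -[n in 'i%C ^+ n]odd_double_half exprD -mul2n exprM sqr_i.
  have -> : cos_coeff t n = (~~ odd n)%:R * (-1) ^+ n./2 * t ^+ n / n`!%:R by [].
  have -> : sin_coeff t n = (odd n)%:R * (-1) ^+ n.-1./2 * t ^+ n / n`!%:R by [].
  have -> : n`!%:R^-1 = (n`!%:R^-1)%:C :> R[i] by rewrite fmorphV rmorph_nat.
  rewrite -(rmorphXn (real_complex R)) -[LHS]mulrA -rmorphM.
  have -> : (-1) ^+ n./2 = ((-1) ^+ n./2)%:C :> R[i].
    by rewrite rmorphXn rmorphN1.
  (* The sine coefficient has the exponent [n.-1./2]; for even [n] its parity factor is zero, so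
     only odd [n] need matching. *)
  have pred_half : odd n -> n.-1./2 = n./2.
    by case: n => // n /= /negPf on; rewrite uphalf_half on.
  move: pred_half; case: (odd n) => /= [->//|_]; apply/eqP;
    by rewrite eq_complex /= !(expr0, expr1, oppr0, mul0r, mul1r, mulr0, subr0,
      add0r, addr0) ?mulrA ?eqxx.
have sumE n : series (fun n => ('i%C * t%:C) ^+ n / n`!%:R) n
    = series (cos_coeff t) n +i* series (sin_coeff t) n.
  elim: n => [|n IH]; first by rewrite /series /= !big_geq.
  by rewrite !seriesSr IH coefE.
apply: cvg_complex.
- rewrite (_ : (fun _ => _) = series (cos_coeff t)).
    (* Unlocking exposes [cos t] as the limit of this very series, so convergence suffices. *)
    rewrite unlock; exact: is_cvg_series_cos_coeff.
  by apply/funext => n; rewrite sumE.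
- rewrite (_ : (fun _ => _) = series (sin_coeff t)).
    rewrite unlock; exact: is_cvg_series_sin_coeff.
  by apply/funext => n; rewrite sumE.
Qed.

Lemma sin_intrpi (R : realType) (k : int) : sin (k%:~R * pi : R) = 0.
Proof.
have sinn n : sin (n%:R * pi : R) = 0.
  elim: n => [|n IH]; first by rewrite mul0r sin0.
  by rewrite -natr1 mulrDl mul1r sinDpi IH oppr0.
case: k => n; first exact: sinn.
by rewrite NegzE mulrNz mulNr sinN sinn oppr0.
Qed.

(** With [k] the floor of [x / pi], the remainder [x - k * pi] lies in [[0, pi)] and its sine
    vanishes; since sine is positive on the open interval, the remainder is 0. *)
Lemma sin_eq0P (R : realType) (x : R) :
  sin x = 0 <-> exists k : int, x = k%:~R * pi.
Proof.
split=> [sx0|[k ->]]; last exact: sin_intrpi.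
exists (Num.floor (x / pi)); set k := Num.floor _.
have /andP[kx xk] : k%:~R <= x / pi < (k + 1)%:~R by exact: floor_itv.
rewrite ler_pdivlMr ?pi_gt0// in kx.
rewrite ltr_pdivrMr ?pi_gt0// intrD mulrDl mul1r in xk.
apply/eqP; apply: contraTT isT => xNk.
have /sin_gt0_pi : 0 < x - k%:~R * pi < pi.
  by rewrite subr_gt0 lt_neqAle eq_sym xNk kx ltrBlDl.
by rewrite sinB sx0 sin_intrpi mul0r mulr0 subr0 ltxx.
Qed.

Lemma sum_complex (R : rcfType) (I : Type) (s : seq I) (f g : I -> R) :
  \sum_(i <- s) (f i +i* g i) = (\sum_(i <- s) f i) +i* (\sum_(i <- s) g i).
Proof. by elim: s => [|i s IH]; rewrite ?big_nil// !big_cons IH. Qed.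

Theorem proposition5 (R : realType) (N : nat) (theta : 'rV[R]_N) :
  kuramoto_equilibrium (complete_adj R N) theta <->
  (forall i j : 'I_N, exists k : int, theta 0 i - theta 0 j = k%:~R * pi) \/
  \sum_(i < N) expC ('i%C * (theta 0 i)%:C) = 0.
Proof.
under eq_bigr do rewrite expC_i.
rewrite sum_complex.
set C := \sum_(i < N) cos _; set S := \sum_(i < N) sin _.
(* The zero diagonal entry can be replaced by 1 because [sin 0 = 0], so the sum runs over all [j]
   and the subtraction formula factors it. *)
have fieldE i : \sum_(j < N) complete_adj R N i j * sin (theta 0 j - theta 0 i)
    = S * cos (theta 0 i) - C * sin (theta 0 i).
  rewrite /S /C !mulr_suml -sumrB; apply: eq_bigr => j _.
  rewrite mxE -sinB; have [->|_] := eqVneq i j; last by rewrite mul1r.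
  by rewrite mul0r subrr sin0.
split=> [eqm|[dpi|[C0 S0]] i]; last 2 first.
- apply: big1 => j _; have [k ->] := dpi j i.
  by rewrite sin_intrpi mulr0.
- by rewrite fieldE C0 S0 !mul0r subrr.
have SC i : S * cos (theta 0 i) = C * sin (theta 0 i).
  by apply/eqP; rewrite -subr_eq0 -fieldE eqm.
have [/eqP|CS0] := eqVneq (C +i* S) 0; first by move/eqP; right.
left=> i j; apply/sin_eq0P.
(* Showing that both [C] and [S] annihilate the sine avoids a case split on which of them is
   nonzero; after [SC] is applied at [i] and [j], the two products cancel. *)
have Csin : C * sin (theta 0 i - theta 0 j) = 0.
  transitivity (C * sin (theta 0 i) * cos (theta 0 j)
    - cos (theta 0 i) * (C * sin (theta 0 j))); first by rewrite sinB; ring.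
  by rewrite -!SC; ring.
have Ssin : S * sin (theta 0 i - theta 0 j) = 0.
  transitivity (sin (theta 0 i) * (S * cos (theta 0 j))
    - S * cos (theta 0 i) * sin (theta 0 j)); first by rewrite sinB; ring.
  by rewrite !SC; ring.
apply/eqP; apply: contraNT CS0 => sN0; rewrite eq_complex /=.
by move/eqP: Csin; move/eqP: Ssin; rewrite !mulf_eq0 (negPf sN0) !orbF => -> ->.
Qed.
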